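(* Let $n\geq 6$. Every homomorphism from $\mathrm{Aut}(F_n)$ to $\mathrm{Diff}^2_+(S^1)$ factors through $\mathbb{Z}/2\mathbb{Z}$ (i.e. has image of order at most $2$), and every homomorphism from $\mathrm{Aut}(F_n)$ to $\mathrm{Diff}^2_+(I)$ is trivial. The same two statements hold with $\mathrm{Aut}(F_n)$ replaced by $\mathrm{Out}(F_n)$.
   Context: $F_n$ is the free group of rank $n$; $\mathrm{Aut}(F_n)$ is its automorphism group and $\mathrm{Out}(F_n)$ its outer automorphism group. $\mathrm{Diff}^2_+(M)$ denotes the group of orientation-preserving $C^2$ diffeomorphisms of $M$, and $I=[0,1]$. *)

(* Defs.v *)
From HB Require Import structures.
From mathcomp Require Import all_boot all_order all_algebra.
From mathcomp Require Import all_classical all_reals all_analysis.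
Set Implicit Arguments. Unset Strict Implicit. Unset Printing Implicit Defensive.
Import Order.TTheory GRing.Theory Num.Theory.
Import numFieldNormedType.Exports.
Local Open Scope classical_set_scope.
Local Open Scope ring_scope.

(* A letter (i, b) is the generator x_i if b = false, and x_i^-1 if b = true. *)
Definition letter (n : nat) := ('I_n * bool)%type.

Definition cancels (n : nat) (a b : letter n) : bool := (a.1 == b.1) && (a.2 != b.2).

Definition reduced (n : nat) (w : seq (letter n)) : bool :=
  sorted (fun a b => ~~ cancels a b) w.

Definition reduce (n : nat) (w : seq (letter n)) : seq (letter n) :=
  foldr (fun a s => if s is b :: s' then (if cancels a b then s' else a :: s)
                    else [:: a]) [::] w.

Definition FG (n : nat) := {w : seq (letter n) | reduced w}.

Definition FG1 (n : nat) : FG n := exist _ [::] isT.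

(* group law: concatenate and freely reduce (reduce always yields a reduced word) *)
Definition FGmul (n : nat) (u v : FG n) : FG n :=
  insubd (FG1 n) (reduce (val u ++ val v)).

Definition FGinv (n : nat) (u : FG n) : FG n :=
  insubd (FG1 n) (rev (map (fun a : letter n => (a.1, ~~ a.2)) (val u))).

Definition is_aut (n : nat) (s : FG n -> FG n) : Prop :=
  (forall u v, s (FGmul u v) = FGmul (s u) (s v)) /\ bijective s.

Definition inner (n : nat) (u : FG n) : FG n -> FG n :=
  fun w => FGmul (FGmul u w) (FGinv u).

Definition derive_within (R : realType) (D : set R) (f : R -> R) (x l : R) : Prop :=
  (fun y => (f y - f x) / (y - x)) @ within (D `\ x) (nbhs x) --> l.

Definition C2_on (R : realType) (D : set R) (f : R -> R) : Prop :=
  exists f1 f2 : R -> R,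
    (forall x, D x -> derive_within D f x (f1 x)) /\
    (forall x, D x -> derive_within D f1 x (f2 x)) /\
    {within D, continuous f2}.

Definition Iset (R : realType) : set R := [set x | 0 <= x <= 1].

Definition is_diffI (R : realType) (f : R -> R) : Prop :=
  exists g : R -> R,
    (forall x, Iset x -> [/\ Iset (f x), Iset (g x), g (f x) = x & f (g x) = x]) /\
    C2_on (@Iset R) f /\ C2_on (@Iset R) g /\
    (forall x y, Iset x -> Iset y -> x < y -> f x < f y).

(* ---------- Diff^2_+(S^1), S^1 = R/Z, elements represented by lifts ---------- *)
(* F : R -> R is a lift of an orientation-preserving C^2 diffeomorphism of R/Z *)
Definition is_diffS1 (R : realType) (F : R -> R) : Prop :=
  exists G : R -> R,
    (forall x, F (x + 1) = F x + 1) /\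
    (forall x, G (F x) = x /\ F (G x) = x) /\
    C2_on setT F /\ C2_on setT G /\
    {homo F : x y / x < y}.

(* two lifts define the same circle diffeomorphism *)
Definition circ_eq (R : realType) (F G : R -> R) : Prop :=
  exists k : int, forall x, F x = G x + k%:~R.

Definition hom_Aut_S1 (R : realType) (n : nat) (phi : (FG n -> FG n) -> R -> R) : Prop :=
  (forall s, is_aut s -> is_diffS1 (phi s)) /\
  (forall s t, is_aut s -> is_aut t -> circ_eq (phi (s \o t)) (phi s \o phi t)).

Definition hom_Aut_I (R : realType) (n : nat) (phi : (FG n -> FG n) -> R -> R) : Prop :=
  (forall s, is_aut s -> is_diffI (phi s)) /\
  (forall s t, is_aut s -> is_aut t ->
     forall x, Iset x -> phi (s \o t) x = phi s (phi t x)).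

(* homomorphisms from Out(F_n) = homomorphisms from Aut(F_n) killing Inn(F_n) *)
Definition hom_Out_S1 (R : realType) (n : nat) (phi : (FG n -> FG n) -> R -> R) : Prop :=
  hom_Aut_S1 phi /\ (forall u : FG n, circ_eq (phi (inner u)) id).

Definition hom_Out_I (R : realType) (n : nat) (phi : (FG n -> FG n) -> R -> R) : Prop :=
  hom_Aut_I phi /\ (forall (u : FG n) x, Iset x -> phi (inner u) x = x).

Definition image_le2_S1 (R : realType) (n : nat) (phi : (FG n -> FG n) -> R -> R) : Prop :=
  exists a b : R -> R, forall s, is_aut s -> circ_eq (phi s) a \/ circ_eq (phi s) b.

Definition trivial_I (R : realType) (n : nat) (phi : (FG n -> FG n) -> R -> R) : Prop :=
  forall s, is_aut s -> forall x, Iset x -> phi s x = x.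

(* Main.v *)
(* On the circle, averaging the lifts of the images of the finitely many signed
   permutations of a basis gives an increasing function conjugating these images
   to translations, so they commute, and hence 3-cycles act trivially.  A 3-cycle
   conjugates a transvection x_i -> x_i x_j into one with which its commutator is
   again a transvection, so all transvections die.  The composite of a
   transposition and an inversion x_j -> x_j^-1 is a product of transvections, so
   transpositions and inversions all have the same image, of order at most 2.
   On the interval, an increasing involution is the identity, and inversions,
   transpositions and composites of a transvection x_i -> x_i x_j with the
   inversion of x_j are involutions.

   Both arguments rest on Nielsen's theorem that these elements generate
   Aut(F_n): among the automorphisms s obtained by composing with transvections,
   one minimising the total length of the s(x) (x a basis element or an inverse),
   then a numerical code of their initial halves, never shortens a reduced word;
   every basis element is then the image of a single letter. *)
Require Import Defs.
From HB Require Import structures.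
From mathcomp Require Import all_boot all_order all_algebra.
From mathcomp Require Import all_fingroup.
From mathcomp Require Import all_classical all_reals all_analysis.
From mathcomp Require Import zify.
Set Implicit Arguments. Unset Strict Implicit. Unset Printing Implicit Defensive.
Import Order.TTheory GRing.Theory Num.Theory.

(** * The free group *)

Section FreeGroup.
Variable n : nat.
Implicit Types (a b : letter n) (s t : seq (letter n)) (u v w : FG n).

Definition linv a : letter n := (a.1, ~~ a.2).

Lemma linvK : involutive linv.
Proof. by case=> i b; rewrite /linv /= negbK. Qed.

Lemma cancelsE a b : cancels a b = (b == linv a).
Proof.
case: a b => [i x] [j y]; rewrite /cancels /linv /= xpair_eqE eq_sym.
by case: eqP => //= _; case: x y => [] [].
Qed.

Definition push a s :=
  if s is b :: s' then if cancels a b then s' else a :: s else [:: a].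

Lemma reduce_foldr s : reduce s = foldr push [::] s.
Proof. by []. Qed.

Lemma reduced_cons a s :
  reduced (a :: s) = (if s is b :: _ then ~~ cancels a b else true) && reduced s.
Proof. by case: s. Qed.

Lemma reduced_push a s : reduced s -> reduced (push a s).
Proof.
case: s => // b s /[dup]; rewrite {1}reduced_cons => /andP[_ rs] rbs.
by rewrite /push; case: ifP => // cab; rewrite reduced_cons cab.
Qed.

Lemma reduced_foldr s t : reduced t -> reduced (foldr push t s).
Proof. by move=> rt; elim: s => //= a s; apply: reduced_push. Qed.

Lemma reduce_id s : reduced s -> reduce s = s.
Proof.
elim: s => // a s IHs; rewrite reduced_cons reduce_foldr /= -reduce_foldr.
by case: s IHs => // b s IHs /andP[/negPf ab /IHs ->] /=; rewrite ab.
Qed.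

(** Van der Waerden's trick: by [push], the letters act on reduced words, and inverse letters act by
    inverse maps. Associativity of the product comes from this action. *)
Lemma push_linv a s : reduced s -> push a (push (linv a) s) = s.
Proof.
case: s => [_|b s]; first by rewrite /= cancelsE eqxx.
rewrite reduced_cons /= cancelsE linvK; case: eqP => [-> | _ _] /=.
  by case: s => //= c s /andP[/negPf->].
by rewrite cancelsE eqxx.
Qed.

(** Reduction only deletes adjacent inverse letters, and by [push_linv] their actions cancel. *)
Lemma foldr_push_reduce s t : reduced t -> foldr push t (reduce s) = foldr push t s.
Proof.
move=> rt; elim: s => // a s /= <-; rewrite -/(reduce s).
case: (reduce s) => // b r /=; rewrite cancelsE; case: eqP => // ->.
by rewrite push_linv ?reduced_foldr.
Qed.

Lemma reduced_reduce s : reduced (reduce s).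
Proof. exact: reduced_foldr. Qed.

Lemma val_FGmul u v : val (FGmul u v) = reduce (val u ++ val v).
Proof. by rewrite /FGmul val_insubd reduced_reduce. Qed.

Lemma val_FGmul_foldr u v : val (FGmul u v) = foldr push (val v) (val u).
Proof.
by rewrite val_FGmul reduce_foldr foldr_cat -reduce_foldr reduce_id ?(valP v).
Qed.

Definition winv s := rev (map linv s).

Lemma winvK : involutive winv.
Proof. by move=> s; rewrite /winv map_rev revK mapK //; exact: linvK. Qed.

Lemma winv_cat s t : winv (s ++ t) = winv t ++ winv s.
Proof. by rewrite /winv map_cat rev_cat. Qed.

Lemma size_winv s : size (winv s) = size s.
Proof. by rewrite size_rev size_map. Qed.

Lemma reduced_winv s : reduced s -> reduced (winv s).
Proof.
rewrite /reduced /winv rev_sorted sorted_map; congr (is_true _).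
apply: eq_sorted => a b /=; congr negb.
by rewrite !cancelsE linvK eq_sym.
Qed.

Lemma val_FGinv u : val (FGinv u) = winv (val u).
Proof. by rewrite /FGinv val_insubd reduced_winv ?(valP u). Qed.

Lemma FGmulA : associative (@FGmul n).
Proof.
move=> u v w; apply: val_inj; rewrite [RHS]val_FGmul_foldr (val_FGmul u v).
by rewrite foldr_push_reduce ?(valP w) // foldr_cat !val_FGmul_foldr.
Qed.

Lemma FGmul1 : left_id (FG1 n) (@FGmul n).
Proof. by move=> u; apply: val_inj; rewrite val_FGmul_foldr. Qed.

Lemma FGmulr1 : right_id (FG1 n) (@FGmul n).
Proof.
by move=> u; apply: val_inj; rewrite val_FGmul cats0 reduce_id ?(valP u).
Qed.

Lemma foldr_push_winv s : reduced s -> foldr push s (winv s) = [::].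
Proof.
elim: s => // a s IHs; rewrite reduced_cons => /andP[_ rs].
by rewrite /winv map_cons rev_cons foldr_rcons /= cancelsE linvK eqxx IHs.
Qed.

Lemma FGmulV : left_inverse (FG1 n) (@FGinv n) (@FGmul n).
Proof.
move=> u; apply: val_inj.
by rewrite val_FGmul_foldr val_FGinv foldr_push_winv ?(valP u).
Qed.

Lemma FGmulrV : right_inverse (FG1 n) (@FGinv n) (@FGmul n).
Proof.
move=> u; apply: val_inj; rewrite val_FGmul_foldr val_FGinv.
by rewrite -{2}[val u]winvK foldr_push_winv ?reduced_winv ?(valP u).
Qed.

End FreeGroup.

HB.instance Definition _ n :=
  Choice.copy (FG n) {w : seq (letter n) | reduced w}.
HB.instance Definition _ n := isGroup.Build (FG n)
  (@FGmulA n) (@FGmul1 n) (@FGmulr1 n) (@FGmulV n) (@FGmulrV n).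

(** * Universal property of the free group *)

Section Extension.
Local Open Scope group_scope.
Variable n : nat.
Implicit Types (a b : letter n) (u v w : FG n) (x y : 'I_n -> FG n).

Definition gen a : FG n := exist _ [:: a] isT.

Lemma gen_linv a : gen (linv a) = (gen a)^-1.
Proof. by apply: val_inj; rewrite [RHS]val_FGinv. Qed.

Lemma gen_inj : injective gen.
Proof. by move=> a b /(congr1 val)[]. Qed.

Lemma FG_prod w : w = \prod_(a <- val w) gen a.
Proof.
case: w => s; elim: s => [|a s IHs] rs.
  by rewrite big_nil; apply: val_inj.
have /andP[_ rs'] : _ && reduced s := etrans (esym (reduced_cons a s)) rs.
rewrite /= big_cons -(IHs rs'); apply: val_inj.
by rewrite [RHS]val_FGmul /= -[RHS]/(reduce (a :: s)) reduce_id.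
Qed.

Definition letter_val x a := if a.2 then (x a.1)^-1 else x a.1.

Lemma letter_val_linv x a : letter_val x (linv a) = (letter_val x a)^-1.
Proof. by rewrite /letter_val /=; case: a.2; rewrite /= ?invgK. Qed.

Definition ext x w := \prod_(a <- val w) letter_val x a.

Lemma ext_gen x a : ext x (gen a) = letter_val x a.
Proof. by rewrite /ext /= big_cons big_nil mulg1. Qed.

Lemma prod_reduce x (s : seq (letter n)) :
  \prod_(a <- reduce s) letter_val x a = \prod_(a <- s) letter_val x a.
Proof.
elim: s => // a s IHs; rewrite [RHS]big_cons -IHs /= -/(reduce s).
case: (reduce s) => [|b r] /=; first by rewrite big_cons.
case: ifP => [|_]; rewrite ?big_cons // cancelsE => /eqP->.
by rewrite letter_val_linv mulVKg.
Qed.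

Lemma extM x : {morph ext x : u v / u * v}.
Proof.
by move=> u v; rewrite /ext [val _]val_FGmul prod_reduce big_cat.
Qed.

End Extension.

Section Automorphisms.
Local Open Scope group_scope.
Variable n : nat.
Implicit Types (a b : letter n) (u v w : FG n) (x y : 'I_n -> FG n)
  (s t : FG n -> FG n).

Lemma is_autM s : is_aut s -> {morph s : u v / u * v}.
Proof. by case. Qed.

Lemma is_aut_inj s : is_aut s -> injective s.
Proof. by case=> _ /bij_inj. Qed.

Section Morph.
Variable s : FG n -> FG n.
Hypothesis sM : {morph s : u v / u * v}.

Lemma morph_FG1 : s 1 = 1.
Proof. by apply: (@mulgI _ (s 1)); rewrite -sM !mulg1. Qed.

Lemma morph_FGV : {morph s : u / u^-1}.
Proof.
by move=> u; apply: (@mulgI _ (s u)); rewrite -sM !mulgV morph_FG1.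
Qed.

Lemma morph_FG_prod w : s w = \prod_(a <- val w) s (gen a).
Proof.
by rewrite {1}[w]FG_prod; apply: (big_morph s sM morph_FG1).
Qed.

Lemma morph_letter a : s (gen a) = letter_val (fun i => s (gen (i, false))) a.
Proof.
case: a => i [] //; rewrite /letter_val /=.
by rewrite -morph_FGV -gen_linv.
Qed.
End Morph.

Lemma morph_FG_ext s t : {morph s : u v / u * v} -> {morph t : u v / u * v} ->
  (forall i, s (gen (i, false)) = t (gen (i, false))) -> s =1 t.
Proof.
move=> sM tM st w; rewrite (morph_FG_prod sM) (morph_FG_prod tM).
apply: eq_bigr => a _; rewrite (morph_letter sM) (morph_letter tM).
by rewrite /letter_val st.
Qed.

Lemma is_aut_id : is_aut (@id (FG n)).
Proof. by split=> //; exists id. Qed.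

Lemma is_aut_comp s t : is_aut s -> is_aut t -> is_aut (s \o t).
Proof.
move=> [sM sb] [tM tb]; split; last exact: bij_comp.
by move=> u v; rewrite /= tM sM.
Qed.

Lemma is_aut_inv s t : cancel s t -> cancel t s -> is_aut s -> is_aut t.
Proof.
move=> st ts [sM _]; split; last by exists s.
by move=> u v; apply: (can_inj st); rewrite ts sM !ts.
Qed.

End Automorphisms.

(** * Length and cancellation *)

Section CommonPrefix.
Variable T : eqType.
Implicit Types s t r : seq T.

Fixpoint lcp s t : nat :=
  match s, t with
  | a :: s', b :: t' => if a == b then (lcp s' t').+1 else 0
  | _, _ => 0
  end.

Lemma leq_lcp k s t :
  (k <= lcp s t) = [&& k <= size s, k <= size t & take k s == take k t].
Proof.
elim: k s t => [|k IHk] [|a s] [|b t] //=; first by rewrite ltn0 andbF.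
by rewrite eqseq_cons; case: eqP => _ /=; rewrite ?ltnS ?IHk ?andbF.
Qed.

Lemma lcpC s t : lcp s t = lcp t s.
Proof. by elim: s t => [|a s IHs] [|b t] //=; rewrite IHs eq_sym. Qed.

(** The ultrametric inequality for common prefixes, which expresses that the Cayley graph is a
    tree. *)
Lemma lcp_trans k s t r : k <= lcp s t -> k <= lcp t r -> k <= lcp s r.
Proof. by rewrite !leq_lcp => /and3P[-> _ /eqP->] /and3P[_ -> ->]. Qed.

Lemma lcpss s : lcp s s = size s.
Proof. by elim: s => //= a s ->; rewrite eqxx. Qed.

Lemma lcp_size s t : lcp s t <= size t.
Proof. by have := leqnn (lcp s t); rewrite leq_lcp => /and3P[]. Qed.

Lemma take_lcp s t : take (lcp s t) s = take (lcp s t) t.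
Proof. by have := leqnn (lcp s t); rewrite leq_lcp => /and3P[_ _ /eqP]. Qed.
End CommonPrefix.

Section Code.
Variable T : finType.
Implicit Types s t r : seq T.

(* [s] read as a number in base [#|T|]. *)
Definition code s := foldl (fun k a => k * #|T| + enum_rank a) 0 s.

Lemma code_cat s t : code (s ++ t) = code s * #|T| ^ size t + code t.
Proof.
elim/last_ind: t => [|t a IHt]; first by rewrite cats0 muln1 addn0.
rewrite -rcons_cat /code !foldl_rcons -!/(code _) IHt size_rcons expnSr.
by rewrite mulnDl mulnA addnA.
Qed.

(** The last digit and the remaining ones are recovered as remainder and quotient modulo the
    base. *)
Lemma code_inj s t : size s = size t -> code s = code t -> s = t.
Proof.
elim/last_ind: s t => [|s a IHs] t; first by case: t.
case/lastP: t => [|t b]; rewrite !size_rcons // => -[szst].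
rewrite /code !foldl_rcons -!/(code _) => eq_code.
have B (c : T) : enum_rank c < #|T| by [].
have B0 : 0 < #|T| by apply: leq_ltn_trans (B a).
have := congr1 (modn^~ #|T|) eq_code; have := congr1 (divn^~ #|T|) eq_code.
rewrite /= !divnMDl // !modnMDl !(divn_small (B _)) !(modn_small (B _)) !addn0.
by move=> /(IHs _ szst)-> /ord_inj/enum_rank_inj->.
Qed.
End Code.

Section Length.
Variable n : nat.
Local Open Scope group_scope.
Implicit Types (a b : letter n) (s t : seq (letter n)) (u v w : FG n).

Lemma reduced_cat_rcons s a t :
  reduced (rcons s a ++ t) = reduced (rcons s a) && reduced (a :: t).
Proof.
by case: s => [|b s] //=; rewrite /reduced /= cat_path last_rcons.
Qed.

Lemma reduced_catl s t : reduced (s ++ t) -> reduced s.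
Proof. by case: s => [|b s] //=; rewrite /reduced /= cat_path => /andP[]. Qed.

Lemma reduce_catr s t : reduced t -> reduce (s ++ t) = foldr (@push n) t s.
Proof. by move=> rt; rewrite reduce_foldr foldr_cat -reduce_foldr reduce_id. Qed.

(** All cancellation takes place at the junction: what disappears from [t] is its longest common
    prefix with the inverse of [s]. *)
Lemma reduce_cat s t : reduced s -> reduced t ->
  let c := lcp (winv s) t in reduce (s ++ t) = take (size s - c) s ++ drop c t.
Proof.
rewrite /=; elim/last_ind: s t => [|s a IHs] t rsa rt.
  by rewrite /= drop0 reduce_id.
have rs : reduced s by move: rsa; rewrite -cats1 => /reduced_catl.
have -> : winv (rcons s a) = linv a :: winv s.
  by rewrite /winv map_rcons rev_rcons.
case: t rt => [|b t] rbt.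
  by rewrite /= cats0 subn0 take_size cats0 reduce_id.
rewrite [lcp _ _]/=; case: eqP => [ab | /eqP ab].
  have := rbt; rewrite reduced_cons => /andP[_ rt].
  rewrite size_rcons subSS -cats1 takel_cat ?leq_subr //=.
  by rewrite -IHs // !reduce_catr // foldr_cat /= cancelsE ab eqxx.
rewrite subn0 take_size drop0 reduce_id //.
by rewrite reduced_cat_rcons rsa reduced_cons cancelsE eq_sym ab rbt.
Qed.

Definition len u := size (val u).

(* The Gromov product of u and v in the Cayley tree, based at 1. *)
Definition gp u v := lcp (val u) (val v).

Lemma val_mulg u v : let c := gp u^-1 v in
  val (u * v) = take (len u - c) (val u) ++ drop c (val v).
Proof.
by rewrite /= [LHS]val_FGmul reduce_cat ?(valP u) ?(valP v) // -val_FGinv.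
Qed.

Lemma lenV u : len u^-1 = len u.
Proof. by rewrite /len [val _]val_FGinv size_winv. Qed.

Lemma gpC u v : gp u v = gp v u.
Proof. exact: lcpC. Qed.

Lemma gp_le u v : gp u v <= len v.
Proof. exact: lcp_size. Qed.

Lemma len_mulg u v : len (u * v) + (gp u^-1 v).*2 = len u + len v.
Proof.
have := gp_le u^-1 v; have := gp_le v u^-1; rewrite gpC lenV.
by rewrite {3}/len val_mulg size_cat size_drop size_take -!/(len _); case: ifP; lia.
Qed.

Lemma len_eq0 u : (len u == 0) = (u == 1).
Proof. by rewrite /len size_eq0. Qed.

(** If a reduced word agreed with its inverse on half of its length, its middle letter would be its
    own inverse (odd length), or its two middle letters would cancel (even length). *)
Lemma gpV_double_lt u : u != 1 -> (gp u^-1 u).*2 < len u.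
Proof.
rewrite -len_eq0 /gp /len [val u^-1]val_FGinv => u_n1.
have ru : reduced (val u) := valP u; move: (val u) ru u_n1 => s rs s_n0.
rewrite ltnNge; apply/negP; set k := lcp _ _ => kP.
have a0 : letter n by case: s s_n0 {kP k rs}.
have nthP i : i < k -> linv (nth a0 s (size s - i.+1)) = nth a0 s i.
  move=> ik; have ks : k <= size s by apply: lcp_size.
  rewrite -(nth_take a0 ik) /k -take_lcp -/k nth_take // nth_rev ?size_map; last lia.
  by rewrite (nth_map a0) //; lia.
have [m [odd_s | even_s]] : exists m, size s = m.*2.+1 \/ size s = m.+1.*2.
  by exists ((size s).-1)./2; lia.
- have /nthP : m < k by lia.
  rewrite odd_s (_ : _ - _ = m); last lia.
  by case: (nth a0 s m) => i []; case.
- have /nthP : m < k by lia.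
  rewrite even_s (_ : _ - _ = m.+1) => [eq_m|]; last lia.
  have /(sortedP a0) := rs => /(_ m).
  by rewrite cancelsE -eq_m linvK eqxx even_s => /(_ ltac:(lia)).
Qed.

End Length.

(** * Nielsen's theorem *)

Section Elementary.
Variable n : nat.
Local Open Scope group_scope.
Implicit Types (a b c : letter n) (u v w : FG n) (s t : FG n -> FG n).

(* The Nielsen transvection a |-> a b, for letters a and b. *)
Definition tv a b := ext (fun i =>
  if i == a.1 then
    if a.2 then (gen b)^-1 * gen (i, false) else gen (i, false) * gen b
  else gen (i, false)).

Lemma tvM a b : {morph tv a b : u v / u * v}.
Proof. exact: extM. Qed.

Lemma tv_same a b : tv a b (gen a) = gen a * gen b.
Proof.
rewrite /tv ext_gen /letter_val eqxx; case: a => i [] //=.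
by rewrite invgM invgK -gen_linv.
Qed.

Lemma tv_other a b c : c.1 != a.1 -> tv a b (gen c) = gen c.
Proof.
move=> /negPf ca; rewrite /tv ext_gen /letter_val ca.
by case: c {ca} => i [] //=; rewrite -gen_linv.
Qed.

Lemma letter_same_index a b : a.1 = b.1 -> a = b \/ a = linv b.
Proof.
by case: a b => i [] [j []] /= ->; [left | right | right | left].
Qed.

Lemma tvK a b : a.1 != b.1 -> cancel (tv a b) (tv a (linv b)).
Proof.
move=> ab; apply: morph_FG_ext => [u v|//|i]; first by rewrite /= !tvM.
pose M := morph_FGV (@tvM a (linv b)).
have tvKa : tv a (linv b) (tv a b (gen a)) = gen a.
  by rewrite tv_same tvM tv_same (tv_other _ (c := b)) 1?eq_sym // gen_linv mulgVK.
have [ia | ia] := eqVneq i a.1; last by rewrite !tv_other.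
have [-> // | ->] := @letter_same_index (i, false) a ia.
by rewrite gen_linv !morph_FGV ?tvKa //; apply: tvM.
Qed.

Lemma is_aut_tv a b : a.1 != b.1 -> is_aut (tv a b).
Proof.
move=> ab; split; first exact: tvM.
exists (tv a (linv b)); first exact: tvK.
by move=> u; rewrite -{1}[b]linvK tvK.
Qed.

(* Signed permutations: x_i |-> x_(p i) ^ (-1)^(e i). *)
Definition sp (p : {perm 'I_n}) (e : {ffun 'I_n -> bool}) :=
  ext (fun i => gen (p i, e i)).

Lemma spM p e : {morph sp p e : u v / u * v}.
Proof. exact: extM. Qed.

Lemma sp_gen p e a : sp p e (gen a) = gen (p a.1, e a.1 (+) a.2).
Proof.
rewrite /sp ext_gen /letter_val; case: a => i [] /=; last by rewrite addbF.
by rewrite -gen_linv /linv /= addbT.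
Qed.

Lemma sp_comp p e q f :
  sp p e \o sp q f = sp (q * p) [ffun i => e (q i) (+) f i].
Proof.
apply/funext/morph_FG_ext => [u v|u v|i]; rewrite /= ?spM //.
by rewrite !sp_gen /= ffunE permM !addbF.
Qed.

Lemma sp_eq1 (p : {perm 'I_n}) (e : {ffun 'I_n -> bool}) :
  p =1 id -> e =1 (fun=> false) -> sp p e = id.
Proof.
move=> p1 e0; apply/funext/morph_FG_ext => [|//|i]; first exact: spM.
by rewrite sp_gen /= p1 e0.
Qed.

Lemma is_aut_sp p e : is_aut (sp p e).
Proof.
split; first exact: spM.
exists (sp p^-1 [ffun i => e (p^-1 i)]) => u.
  rewrite -[LHS]/((_ \o _) u) sp_comp sp_eq1 // => i.
    by rewrite mulgV perm1.
  by rewrite !ffunE permK addbb.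
rewrite -[LHS]/((_ \o _) u) sp_comp sp_eq1 // => i.
  by rewrite mulVg perm1.
by rewrite !ffunE addbb.
Qed.

Definition flip i := sp 1 [ffun k => k == i].
Definition swap i j := sp (tperm i j) [ffun=> false].
Definition rho i j := tv (i, false) (j, false).

(** The involution [f] inverts exactly those generators that occur negatively in [a] or [b];
    conjugation by it makes both letters positive. *)
Lemma tv_rho a b : a.1 != b.1 ->
  let f := sp 1 [ffun k => if k == a.1 then a.2 else (k == b.1) && b.2] in
  tv a b = f \o rho a.1 b.1 \o f.
Proof.
move=> ab f; have fM : {morph f : u v / u * v} by exact: spM.
apply/funext/morph_FG_ext => [|u v|i]; first exact: tvM.
  by rewrite /= fM /rho tvM fM.
have fE c : f (gen c) =
    gen (c.1, (if c.1 == a.1 then a.2 else (c.1 == b.1) && b.2) (+) c.2).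
  by rewrite /f sp_gen perm1 ffunE.
rewrite /= fE /rho /=; have [-> | ia] := eqVneq i a.1; last first.
  by rewrite !tv_other // fE /= (negPf ia) addbF addbb.
have -> : gen (a.1, a.2 (+) false) = gen a by rewrite addbF; case: (a).
move: f fM fE => f fM; case: a b ab => [i' []] [j y] /= ij fE.
  rewrite {1}/tv ext_gen /letter_val /= eqxx.
  rewrite -[(i', true)]/(linv (i', false)) gen_linv.
  rewrite (morph_FGV (@tvM _ _)) tv_same (morph_FGV fM) fM !fE /= !eqxx.
  rewrite eq_sym (negPf ij) /= addbF invgM; congr (_ * _).
  by rewrite -gen_linv.
by rewrite !tv_same fM !fE /= !eqxx eq_sym (negPf ij) /= addbF.
Qed.

End Elementary.

(** The tie-breaker between automorphisms of equal total length. A change in the first half of a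
    word leaves the first half of its inverse alone. *)
Definition half_code n (u : FG n) :=
  code (take (uphalf (len u)) (val u) : seq (letter n)).

Definition total n (F : FG n -> nat) (s : FG n -> FG n) :=
  \sum_(a : letter n) F (s (gen a)).

(** * Cancellation in the image of a minimal automorphism *)

Section NielsenReduced.
Variable n : nat.
Local Open Scope group_scope.
Variable s : FG n -> FG n.
Hypothesis s_aut : is_aut s.
Implicit Types (a b c : letter n) (u v w : FG n).

Let U a := s (gen a).

Let sM : {morph s : u v / u * v}.
Proof. exact: is_autM. Qed.

Let UV a : U (linv a) = (U a)^-1.
Proof. by rewrite /U gen_linv morph_FGV. Qed.

(** Only the terms at [a] and [linv a] change. The old ones are added on the left to avoid
    subtraction of naturals. *)
Lemma sum_tv (F : FG n -> nat) a b : a.1 != b.1 ->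
  (total F (s \o tv a b) + (F (U a) + F (U a)^-1%g)
  = total F s + (F (U a * U b)%g + F (U a * U b)^-1%g))%N.
Proof.
move=> ab.
have la : linv a != a by case: (a) => i []; rewrite xpair_eqE andbF.
pose rest G := (\sum_(c | (c != a) && (c != linv a)) G c)%N.
have sumE (G : letter n -> nat) : (\sum_c G c = G a + (G (linv a) + rest G))%N.
  by rewrite (bigD1 a) //= (bigD1 (linv a)).
have restE : rest (fun c => F (s (tv a b (gen c)))) = rest (fun c => F (U c)).
  apply: eq_bigr => c /andP[ca cla]; rewrite tv_other //.
  by apply: contraNneq ca => /letter_same_index[-> //| cE]; rewrite cE eqxx in cla.
rewrite /total !sumE restE /= gen_linv (morph_FGV (@tvM _ a b)) tv_same.
rewrite !(morph_FGV sM) //.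
by rewrite sM -/(U a) -/(U b); set X := rest _; lia.
Qed.

Hypothesis s_min : forall a b, a.1 != b.1 ->
  (total (@len n) s <= total (@len n) (s \o tv a b))%N /\
  (total (@len n) (s \o tv a b) = total (@len n) s ->
    total (@half_code n) s <= total (@half_code n) (s \o tv a b))%N.

Let U_len a b : a.1 != b.1 -> len (U a) <= len (U a * U b).
Proof.
move=> ab; have [+ _] := s_min ab; have := sum_tv (@len n) ab.
by rewrite !lenV; lia.
Qed.

Let U_code a b : a.1 != b.1 -> len (U a * U b) = len (U a) ->
  (half_code (U a) + half_code (U a)^-1%g
   <= half_code (U a * U b)%g + half_code (U a * U b)^-1%g)%N.
Proof.
move=> ab eq_len; have [_] := s_min ab; have := sum_tv (@len n) ab.
have := sum_tv (@half_code n) ab.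
rewrite !lenV eq_len => + eL.
by move=> + /(_ ltac:(lia)); lia.
Qed.

Let U_n1 a : U a != 1.
Proof.
apply/eqP; rewrite -(morph_FG1 sM) => /(is_aut_inj s_aut)/(congr1 val).
by [].
Qed.

Let len_gt0 a : 0 < len (U a).
Proof. by rewrite lt0n len_eq0 U_n1. Qed.

(* Number of letters cancelled at the junction of U a and U b. *)
Let cc a b := gp (U a)^-1 (U b).

Let ccV a b : cc (linv b) (linv a) = cc a b.
Proof. by rewrite /cc !UV invgK gpC. Qed.

Let len_UU a b : (len (U a * U b)%g + (cc a b).*2 = len (U a) + len (U b))%N.
Proof. exact: len_mulg. Qed.

Let cc_lt a b : b != linv a -> a.1 = b.1 -> (cc a b).*2 < len (U b).
Proof.
move=> ba; case/letter_same_index => [eab | eab]; last by rewrite eab linvK eqxx in ba.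
by rewrite /cc eab gpV_double_lt.
Qed.

(** For distinct indices, cancelling more than half of [U b] would make [U a * U b] shorter than
    [U a]; for equal indices [a = b], and a word cancels less than half of itself. *)
Let cc_ler a b : b != linv a -> (cc a b).*2 <= len (U b).
Proof.
move=> ba; have [/(cc_lt ba)/ltnW // | ab] := eqVneq a.1 b.1.
by have := len_UU a b; have := U_len ab; lia.
Qed.

Let cc_lel a b : b != linv a -> (cc a b).*2 <= len (U a).
Proof.
move=> ba; rewrite -ccV -[len (U a)]lenV -UV; apply: cc_ler.
have linv_can2 := can2_eq (@linvK n) (@linvK n).
by rewrite linvK linv_can2 eq_sym linv_can2 eq_sym in ba *.
Qed.

(* Write U b = p q^-1 with p and q of equal length, and U c = q r.  Replacing
   U c by U b * U c = p r keeps all lengths and, among the initial halves of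
   the U a, only changes that of U c: so minimality compares p with q. *)
Let tie b c : b.1 != c.1 -> (cc b c).*2 = len (U b) ->
  (cc b c).*2 <= len (U c) ->
  (code (take (cc b c) (val (U b)^-1%g) : seq (letter n))
   <= code (take (cc b c) (val (U b)) : seq (letter n)))%N.
Proof.
move=> bc; set m := cc b c => mb mc.
(* Left multiplication of [U c] by [U b] is the transvection of [linv c] by [linv b], seen through
   inverses. *)
have cb : (linv c).1 != (linv b).1 by rewrite eq_sym.
have eq_len : len (U b * U c) = len (U c) by have := len_UU b c; lia.
have := U_code cb; rewrite !UV -invgM !lenV => /(_ eq_len).
rewrite !invgK.
set z := val (U c); set h := uphalf (len (U c)).
have valbc : val (U b * U c) = take m (val (U b)) ++ drop m z.
  by rewrite val_mulg -/(cc b c) -/m (_ : _ - _ = m); last lia.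
have valc : z = take m (val (U b)^-1) ++ drop m z.
  by rewrite take_lcp cat_take_drop.
have szm : size (take m (val (U b))) = m by rewrite size_takel // -/(len _); lia.
have szmV : size (take m (val (U b)^-1)) = m.
  by rewrite size_takel // -/(len _) lenV; lia.
have szd : size (drop m z) = (len (U c) - m)%N by rewrite size_drop.
(* Since [m] is at most half the length, the initial half of the inverse ends before the replaced
   prefix is reached. *)
have halfV p : size p = m ->
    take h (winv (p ++ drop m z)) = take h (winv (drop m z)).
  by move=> szp; rewrite winv_cat takel_cat // size_winv szd /h; lia.
have halfE p : size p = m -> take h (p ++ drop m z) = p ++ take (h - m) (drop m z).
  by move=> szp; rewrite take_cat szp ltnNge (_ : m <= h) // /h; lia.
rewrite /half_code !lenV eq_len -/h !/(val _^-1) [val (U c)^-1]val_FGinv.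
rewrite [val (U b * U c)^-1]val_FGinv valbc -/z {1 2}valc !halfV // !halfE //.
(* Both codes now end in the same digits, so the comparison is between the leading prefixes, each
   multiplied by [B]. *)
rewrite !code_cat; set B := (_ ^ _)%N; have B_gt0 : 0 < B.
  by rewrite /B expn_gt0 (leq_ltn_trans _ (ltn_ord (enum_rank b))).
by rewrite leq_add2l leq_add2r leq_pmul2r.
Qed.

(** Otherwise each side cancels exactly half of [U b]. Two uses of [tie] then force the first halves
    of [U b] and of its inverse to coincide, against [gpV_double_lt]. *)
Let cc_add_lt a b c : b != linv a -> c != linv b ->
  (cc a b + cc b c < len (U b))%N.
Proof.
move=> ba cb; rewrite ltnNge; apply/negP => len_le.
have := cc_ler ba; have := cc_lel cb => bc_le ab_le.
have abE : (cc a b).*2 = len (U b) by lia.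
have bcE : (cc b c).*2 = len (U b) by lia.
have eq_m : cc a b = cc b c by lia.
have ab : a.1 != b.1.
  by apply/eqP => /(cc_lt ba); rewrite abE ltnn.
have bc : b.1 != c.1.
  apply/eqP => cb1; have : (linv c).1 = (linv b).1 by [].
  move/cc_lt; rewrite linvK ccV UV lenV bcE ltnn.
  by rewrite eq_sym => /(_ cb).
have le1 := tie bc bcE (cc_ler cb).
have ba' : (linv b).1 != (linv a).1 by rewrite eq_sym.
(* The reverse inequality is [tie] for the inverse pair [linv b], [linv a]. *)
have le2 : (code (take (cc b c) (val (U b)) : seq (letter n))
   <= code (take (cc b c) (val (U b)^-1%g) : seq (letter n)))%N.
  have := tie ba'; rewrite !ccV !UV !lenV invgK eq_m; apply=> //.
  by rewrite -eq_m cc_lel.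
have /code_inj eq_take : code (take (cc b c) (val (U b)^-1%g) : seq (letter n))
  = code (take (cc b c) (val (U b)) : seq (letter n)) by lia.
have := gpV_double_lt (U_n1 b); rewrite ltnNge -bcE leq_double leq_lcp.
rewrite -/(len _) -/(len _) lenV eq_take ?eqxx ?andbT; first by lia.
by rewrite !size_takel // -/(len _) ?lenV; lia.
Qed.

Let prodU (w : seq (letter n)) := \prod_(a <- w) U a.

Let ch a (w : seq (letter n)) := if w is b :: _ then cc a b else 0%N.

(* At most cc a b letters of U a are ever cancelled, since by cc_add_lt
   cancellation does not reach across the whole of U b. *)
Let growth a (w : seq (letter n)) : reduced (a :: w) ->
  len (U a) - ch a w <= gp (prodU (a :: w)) (U a) /\
  (len (U a) + size w <= len (prodU (a :: w)) + ch a w)%N.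
Proof.
elim: w a => [|b w IHw] a rw.
  by rewrite /prodU big_seq1 /= /gp lcpss subn0 addn0.
move: rw; rewrite reduced_cons cancelsE => /andP[ba rbw].
have [le_gp le_len] := IHw _ rbw.
have lt_b : (cc a b + ch b w < len (U b))%N.
  case: w rbw {IHw le_gp le_len} => [|c w] rbw.
    by have := cc_ler ba; have := len_gt0 b; rewrite /=; lia.
  by move: rbw; rewrite reduced_cons cancelsE => /andP[cb _]; apply: cc_add_lt.
(* The product agrees with [U b] beyond the first [cc a b] letters, so by the ultrametric inequality
   it cancels against [U a] exactly as [U b] does. *)
have gpE : gp (U a)^-1 (prodU (b :: w)) = cc a b.
  have lt_gp : (cc a b < gp (prodU (b :: w)) (U b))%N by lia.
  apply/eqP; rewrite eqn_leq; apply/andP; split.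
    rewrite leqNgt; apply/negP => /lcp_trans/(_ lt_gp).
    by rewrite -/(gp _ _) -/(cc a b) ltnn.
  by apply: (@lcp_trans _ _ _ (val (U b))); rewrite // -/(gp _ _) gpC ltnW.
rewrite {1 2}/prodU !(big_cons _ _ a) -!/(prodU _); split.
  rewrite /= leq_lcp val_mulg gpE leq_subr /=.
  have szk : size (take (len (U a) - cc a b) (val (U a))) = (len (U a) - cc a b)%N.
    by rewrite size_takel // leq_subr.
  by rewrite size_cat szk leq_addr take_size_cat /=.
have := len_mulg (U a) (prodU (b :: w)); rewrite gpE /=.
by lia.
Qed.

(** By [growth], a reduced word with at least two letters has an image of length at least two, so
    the preimage of a letter is a single letter. *)
Lemma min_surj_letter a : exists b, s (gen b) = gen a.
Proof.
have [t st ts] : bijective s by case: s_aut.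
have := morph_FG_prod sM (t (gen a)); rewrite ts.
case: (t _) => [[|b w] rw] /= def_a.
  by have := congr1 val def_a; rewrite big_nil.
exists b; case: w rw def_a => [|c w] rw; first by rewrite big_seq1.
have /andP[] : _ && reduced (c :: w) := etrans (esym (reduced_cons b _)) rw.
rewrite cancelsE => /cc_lel bc _ def_a; have [_] := growth rw.
rewrite /prodU /U -def_a /= -/(U b); have := len_gt0 b.
by rewrite [len (gen a)]/len /=; lia.
Qed.

End NielsenReduced.

#[local] Hint Resolve is_aut_sp : core.

(** * Generation of Aut(F_n), as an induction principle *)

Section Generation.
Variable n : nat.
Local Open Scope group_scope.
Implicit Types (a b c : letter n) (u v w : FG n) (s t : FG n -> FG n).
Variable P : (FG n -> FG n) -> Prop.
Hypothesis P_id : P id.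
Hypothesis P_comp : forall s t, is_aut s -> is_aut t -> P s -> P t -> P (s \o t).
Hypothesis P_flip : forall i, P (flip i).
Hypothesis P_swap : forall i j, i != j -> P (swap i j).
Hypothesis P_rho : forall i j, i != j -> P (rho i j).

(** A signed permutation is a sign change followed by a permutation: the latter is a product of
    transpositions, the former a product of flips over the negated indices. *)
Lemma generation_sp p e : P (sp p e).
Proof.
have -> : sp p e = sp p [ffun=> false] \o sp 1 e.
  by rewrite sp_comp mul1g; congr sp; apply/ffunP => i; rewrite !ffunE.
apply: P_comp => //.
  have [ts -> {p}] := prod_tpermP p; elim: ts => [_|[i j] ts IHts] /=.
    by rewrite big_nil sp_eq1 // => i; rewrite ?perm1 ?ffunE.
  case/andP=> ij /IHts Pts; rewrite big_cons /=.
  have -> : sp (tperm i j * \prod_(t <- ts) tperm t.1 t.2) [ffun=> false]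
      = sp (\prod_(t <- ts) tperm t.1 t.2) [ffun=> false] \o swap i j.
    by rewrite sp_comp; congr sp; apply/ffunP => k; rewrite !ffunE.
  by apply: P_comp => //; [apply: is_aut_sp | apply: P_swap].
have -> : e = [ffun i => i \in enum [pred i | e i]].
  by apply/ffunP => i; rewrite ffunE mem_enum inE.
elim: (enum _) (enum_uniq [pred i | e i]) => [_|i l IHl] /=.
  by rewrite sp_eq1 // => i; rewrite ?perm1 ?ffunE.
case/andP=> il /IHl Pl.
have -> : sp 1 [ffun k => k \in i :: l] = sp 1 [ffun k => k \in l] \o flip i.
  rewrite sp_comp mul1g; congr sp; apply/ffunP => k; rewrite !ffunE perm1.
  by rewrite inE; case: eqP => [->|_]; rewrite ?(negPf il) ?addbF.
by apply: P_comp => //; apply: is_aut_sp.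
Qed.

Lemma generation_tv a b : a.1 != b.1 -> P (tv a b).
Proof.
move=> ab; rewrite tv_rho //.
have rho_aut : is_aut (rho a.1 b.1) by apply: is_aut_tv.
apply: P_comp => //; last exact: generation_sp.
  by apply: is_aut_comp.
by apply: P_comp => //; [apply: generation_sp | apply: P_rho].
Qed.

Lemma generation_min s : is_aut s ->
  (forall a b, a.1 != b.1 ->
    total (@len n) s <= total (@len n) (s \o tv a b) /\
    (total (@len n) (s \o tv a b) = total (@len n) s ->
      total (@half_code n) s <= total (@half_code n) (s \o tv a b))) ->
  P s.
Proof.
move=> s_aut s_min; have sM := is_autM s_aut.
have /fin_all_exists[f fE] i := min_surj_letter s_aut s_min (i, false).
have f_inj : injective (fun i => (f i).1).
  move=> i j /letter_same_index[] eq_f; have := fE i; rewrite eq_f.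
    by rewrite fE => /gen_inj[].
  by rewrite gen_linv (morph_FGV sM) fE -gen_linv => /gen_inj[].
(* [f] records which letter [s] sends to each positive generator; [s] itself therefore permutes
   indices by the inverse. *)
pose p := (perm f_inj)^-1.
suff -> : s = sp p [ffun i => (f (p i)).2] by apply: generation_sp.
apply/funext/morph_FG_ext => [//|u v|i]; first exact: spM.
have := fE (p i); rewrite sp_gen ffunE /= addbF.
have := permKV (perm f_inj) i; rewrite -/p permE.
case: (f (p i)) => j [] /= -> // sE.
by rewrite -[(p i, true)]/(linv (p i, false)) gen_linv -sE -(morph_FGV sM) -gen_linv.
Qed.

(** Lexicographic descent on (total length, total code): either [s] is minimal, or some transvection
    lowers the pair and is undone by its inverse. *)
Theorem nielsen_generation s : is_aut s -> P s.
Proof.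
move: {-2}(total (@len n) s) (erefl (total (@len n) s)) => L.
elim/ltn_ind: L s => L IHL s.
move: {-2}(total (@half_code n) s) (erefl (total (@half_code n) s)) => C.
elim/ltn_ind: C s => C IHC s sC sL s_aut.
have [s_min | ] := pselect (forall a b, a.1 != b.1 ->
    total (@len n) s <= total (@len n) (s \o tv a b) /\
    (total (@len n) (s \o tv a b) = total (@len n) s ->
      total (@half_code n) s <= total (@half_code n) (s \o tv a b))).
  exact: generation_min.
move=> /existsNP[a /existsNP[b /not_implyP[ab not_min]]].
have sT_aut : is_aut (s \o tv a b) by apply: is_aut_comp => //; apply: is_aut_tv.
have -> : s = (s \o tv a b) \o tv a (linv b).
  by apply/funext => u /=; rewrite -{1}[b]linvK tvK.
apply: P_comp => //; [exact: is_aut_tv | | exact: generation_tv].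
have [lt_len | le_len] := ltnP (total (@len n) (s \o tv a b)) L.
  exact: IHL lt_len _ erefl sT_aut.
have lenE : total (@len n) (s \o tv a b) = L.
  apply/eqP; rewrite eqn_leq le_len andbT leqNgt; apply/negP => lt_len.
  by apply: not_min; rewrite -sL ltnW //; split=> // eL; rewrite eL ltnn in lt_len.
apply: (IHC _ _ (s \o tv a b) erefl (esym lenE) sT_aut).
rewrite ltnNge sC; apply/negP => le_code; apply: not_min.
by rewrite -sL lenE leqnn.
Qed.

End Generation.

(** * Relations between the generators *)

Section Relations.
Variable n : nat.
Local Open Scope group_scope.
Implicit Types (i j k : 'I_n) (p : {perm 'I_n}).

Lemma is_aut_flip i : is_aut (@flip n i).
Proof. exact: is_aut_sp. Qed.

Lemma is_aut_swap i j : is_aut (@swap n i j).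
Proof. exact: is_aut_sp. Qed.

Lemma is_aut_rho i j : i != j -> is_aut (@rho n i j).
Proof. by move=> ij; apply: is_aut_tv. Qed.

Lemma flipK i : flip i \o flip i = id.
Proof.
rewrite /flip sp_comp sp_eq1 // => k; first by rewrite permM !perm1.
by rewrite !ffunE perm1 addbb.
Qed.

Lemma swapK i j : swap i j \o swap i j = id.
Proof.
rewrite /swap sp_comp sp_eq1 // => k; first by rewrite permM tpermK.
by rewrite !ffunE.
Qed.

Lemma swap_flip i j : swap i j \o flip j = flip i \o swap i j.
Proof.
rewrite /flip /swap !sp_comp mul1g mulg1; congr sp.
apply/ffunP => k; rewrite !ffunE addbF.
by rewrite (can2_eq (tpermK i j) (tpermK i j)) tpermL.
Qed.

Lemma sp_rho p i j : i != j ->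
  sp p [ffun=> false] \o rho i j = rho (p i) (p j) \o sp p [ffun=> false].
Proof.
move=> ij; apply/funext/morph_FG_ext => [u v|u v|k]; rewrite /rho /=.
- by rewrite tvM spM.
- by rewrite spM tvM.
have spE k' : sp p [ffun=> false] (gen (k', false)) = gen (p k', false).
  by rewrite sp_gen ffunE.
rewrite spE; have [-> | ki] := eqVneq k i.
  by rewrite (tv_same (i, false)) (tv_same (p i, false)) spM !spE.
by rewrite !tv_other /= ?spE // inj_eq //; apply: perm_inj.
Qed.

Lemma rho_flip_involution i j : i != j ->
  (rho i j \o flip j) \o (rho i j \o flip j) = id.
Proof.
move=> ij; have flipM : {morph flip j : u v / u * v} := @spM _ _ _.
apply/funext/morph_FG_ext => [u v|//|k]; rewrite /rho /=.
  by rewrite !(flipM, tvM).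
have flipE k' b : flip j (gen (k', b)) = gen (k', (k' == j) (+) b).
  by rewrite /flip sp_gen ffunE perm1.
rewrite flipE; have [-> | ki] := eqVneq k i.
  rewrite (negPf ij) /= (tv_same (i, false)) flipM tvM !flipE eqxx (negPf ij).
  rewrite (tv_same (i, false)) tv_other 1?eq_sym //.
  by rewrite -[(j, true (+) false)]/(linv (j, false)) gen_linv mulgK.
by rewrite addbF tv_other // flipE tv_other // addbb.
Qed.

(** The Steinberg relation, written without inverses: [rho k j] is a commutator of [rho i j] and
    [rho k i]. *)
Lemma rho_commutator i j k : i != j -> j != k -> k != i ->
  rho i j \o rho k i = (rho k i \o rho i j) \o rho k j.
Proof.
move=> ij jk ki; apply/funext/morph_FG_ext => [u v|u v|l]; rewrite /rho /=.
- by rewrite !tvM.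
- by rewrite !tvM.
have [-> | lk] := eqVneq l k.
  rewrite (tv_same (k, false) (i, false)) (tv_same (k, false) (j, false)) !tvM.
  rewrite !(tv_other _ (a := (i, false)) (c := (k, false))) //.
  rewrite (tv_same (i, false)) (tv_same (k, false)).
  by rewrite !(tv_other _ (c := (j, false))) // 1?eq_sym // mulgA.
rewrite !(tv_other _ (a := (k, false)) (c := (l, false))) //.
have [-> | li] := eqVneq l i; last by rewrite !tv_other.
by rewrite (tv_same (i, false)) tvM !tv_other // eq_sym.
Qed.

(** A lift to the free group of the factorisation of a quarter-turn matrix into three elementary
    matrices. *)
Lemma swap_flip_tv i j : i != j ->
  swap i j \o flip j =
  (tv (i, false) (j, false) \o tv (j, false) (i, true)) \o tv (i, true) (j, true).
Proof.
move=> ij; have ji : j != i by rewrite eq_sym.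
apply/funext/morph_FG_ext => [u v|u v|k] /=.
- by rewrite /swap /flip !spM.
- by rewrite !tvM.
have V a : gen (a, true) = (gen (a, false))^-1 :> FG n by rewrite -gen_linv.
rewrite /swap /flip !sp_gen !ffunE perm1 /= !addbF.
have E1 : tv (i, true) (j, true) (gen (i, false)) = gen (j, false) * gen (i, false).
  have := tv_same (i, true) (j, true); rewrite !V (morph_FGV (@tvM _ _ _)).
  by move=> /(congr1 (fun u => u^-1)); rewrite invgM !invgK.
have [-> | ki] := eqVneq k i.
  rewrite tpermL (negPf ij) E1 !tvM (tv_same (j, false)) (tv_other _ (c := (i, false))) //.
  rewrite tvM V (morph_FGV (@tvM _ _ _)) (tv_other _ (c := (j, false))) //.
  by rewrite (tv_same (i, false)) mulgVK.
have [-> | kj] := eqVneq k j.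
  rewrite tpermR V [tv (i, true) _ _]tv_other // (tv_same (j, false)) tvM V.
  rewrite (morph_FGV (@tvM _ _ _)) (tv_other _ (c := (j, false))) //.
  by rewrite (tv_same (i, false)) invgM mulVKg.
by rewrite tpermD 1?eq_sym // !tv_other.
Qed.

End Relations.

(** * Congruences under which signed permutations commute *)

Section Congruence.
Variable n : nat.
Local Open Scope group_scope.
Implicit Types (i j k : 'I_n) (s t r : FG n -> FG n).
(** It stands for having equal images under the action; the dynamics of the circle enters only
    through [eqv_sp]. *)
Variable eqv : (FG n -> FG n) -> (FG n -> FG n) -> Prop.
Hypothesis eqv_refl : forall s, eqv s s.
Hypothesis eqv_sym : forall s t, eqv s t -> eqv t s.
Hypothesis eqv_trans : forall s t r, eqv s t -> eqv t r -> eqv s r.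
Hypothesis eqv_comp : forall s s' t t', is_aut s -> is_aut s' -> is_aut t ->
  is_aut t' -> eqv s s' -> eqv t t' -> eqv (s \o t) (s' \o t').
Hypothesis eqv_sp : forall p e q f,
  eqv (sp p e \o sp q f) (sp q f \o sp p e).

#[local] Hint Resolve is_aut_id is_aut_sp is_aut_comp is_aut_flip is_aut_swap
  is_aut_rho : core.

Lemma eqv_canl s t r : is_aut s -> is_aut t -> is_aut r ->
  eqv (r \o s) (r \o t) -> eqv s t.
Proof.
move=> s_aut t_aut r_aut rst; have [_ [r' rK Kr]] := r_aut.
have r'_aut := is_aut_inv rK Kr r_aut.
have E (u : FG n -> FG n) : u = r' \o (r \o u) by apply/funext => x /=; rewrite rK.
by rewrite (E s) (E t); apply: eqv_comp => //; apply: is_aut_comp.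
Qed.

Lemma eqv_canr s t r : is_aut s -> is_aut t -> is_aut r ->
  eqv (s \o r) (t \o r) -> eqv s t.
Proof.
move=> s_aut t_aut r_aut rst; have [_ [r' rK Kr]] := r_aut.
have r'_aut := is_aut_inv rK Kr r_aut.
have E (u : FG n -> FG n) : u = (u \o r) \o r' by apply/funext => x /=; rewrite Kr.
by rewrite (E s) (E t); apply: eqv_comp => //; apply: is_aut_comp.
Qed.

Lemma eqv_idl s t : is_aut s -> is_aut t -> eqv s id -> eqv (s \o t) t.
Proof. by move=> s_aut t_aut s1; apply: (eqv_comp _ (is_aut_id n) t_aut). Qed.

Lemma eqv_idr s t : is_aut s -> is_aut t -> eqv t id -> eqv (s \o t) s.
Proof. by move=> s_aut t_aut t1; apply: (eqv_comp _ s_aut _ (is_aut_id n)). Qed.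

Lemma eqv_flip i j : eqv (flip i) (flip j).
Proof.
apply: (@eqv_canl _ _ (swap i j)) => //.
apply: (eqv_trans (t := flip i \o swap i j)); first exact: eqv_sp.
by rewrite swap_flip.
Qed.

(* The commutator of two transpositions: the 3-cycle i |-> k |-> j |-> i. *)
Definition cycle3 i j k := (swap i j \o swap j k) \o (swap i j \o swap j k).

(** Exchanging the two transpositions in the first factor makes the product collapse. *)
Lemma eqv_cycle3 i j k : eqv (cycle3 i j k) id.
Proof.
rewrite -(swapK j k) /cycle3.
have -> : swap j k \o swap j k
    = (swap j k \o swap i j) \o (swap i j \o swap j k) :> (FG n -> FG n).
  by apply/funext => u /=; rewrite -[swap i j (swap i j _)]/((_ \o _) _) swapK.
by apply: eqv_comp; auto; apply: eqv_sp.
Qed.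

(** The 3-cycle conjugates the first transvection to the second, and it is equivalent to [id]. *)
Lemma eqv_rho_cycle i j k : i != j -> j != k -> k != i -> eqv (rho i j) (rho k i).
Proof.
move=> ij jk ki; have [ik ji] : i != k /\ j != i by rewrite !(eq_sym _ i) eq_sym.
have cE : cycle3 i j k
    = sp ((tperm j k * tperm i j) * (tperm j k * tperm i j)) [ffun=> false].
  rewrite /cycle3 /swap !sp_comp; congr sp.
  by apply/ffunP => l; rewrite !ffunE.
have c_aut : is_aut (cycle3 i j k) by rewrite cE.
apply: (eqv_trans (t := cycle3 i j k \o rho i j)).
  by apply: eqv_sym; apply: eqv_idl; auto; apply: eqv_cycle3.
have -> : cycle3 i j k \o rho i j = rho k i \o cycle3 i j k.
  rewrite cE sp_rho //; congr (rho _ _ \o _).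
    by rewrite !permM (tpermD ji ki) tpermL tpermL (tpermD ik jk).
  by rewrite !permM tpermL (tpermD ik jk) !tpermR.
by apply: eqv_idr; auto; apply: eqv_cycle3.
Qed.

Hypothesis n_gt2 : 2 < n.

Lemma third i j : exists k, k != i /\ k != j.
Proof.
have : 0 < #|~: [set i; j]| by rewrite cardsCs finset.setCK card_ord cards2; lia.
by case/card_gt0P=> k; rewrite !inE negb_or => /andP[]; exists k.
Qed.

(** For a third index [k], this is a commutator of [rho k j] and [rho i k], which are equivalent by
    [eqv_rho_cycle]. *)
Lemma eqv_rho i j : i != j -> eqv (rho i j) id.
Proof.
move=> ij; have [k [ki kj]] := third i j.
have ik : i != k by rewrite eq_sym.
have E : eqv (rho k j) (rho i k) by apply: eqv_rho_cycle; rewrite // eq_sym.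
apply: (@eqv_canl _ _ (rho i k \o rho k j)) => //; auto.
rewrite -rho_commutator //; last by rewrite eq_sym.
by rewrite -[_ \o id]/(rho i k \o rho k j); apply: eqv_comp; auto.
Qed.

Lemma eqv_tv (a b : letter n) : a.1 != b.1 -> eqv (tv a b) id.
Proof.
move=> ab; rewrite tv_rho //; set f := sp _ _.
have fK : f \o f = id.
  rewrite /f sp_comp sp_eq1 // => i; first by rewrite permM !perm1.
  by rewrite !ffunE perm1 addbb.
have f_aut : is_aut f by apply: is_aut_sp.
rewrite -fK; apply: eqv_comp; auto.
by apply: eqv_idr; auto; apply: eqv_rho.
Qed.

Lemma eqv_swap i j : i != j -> eqv (swap i j) (flip j).
Proof.
move=> ij; have ji : j != i by rewrite eq_sym.
apply: (@eqv_canr _ _ (flip j)) => //; rewrite flipK swap_flip_tv //.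
set t1 := tv _ _; set t2 := tv _ _; set t3 := tv _ _.
have [a1 a2 a3] : [/\ is_aut t1, is_aut t2 & is_aut t3].
  by split; apply: is_aut_tv.
apply: (eqv_trans (t := t1 \o t2)); first by apply: eqv_idr; auto; apply: eqv_tv.
apply: (eqv_trans (t := t1)); last exact: eqv_tv.
by apply: eqv_idr; auto; apply: eqv_tv.
Qed.

Theorem congruence_le2 (i0 : 'I_n) s : is_aut s -> eqv s id \/ eqv s (flip i0).
Proof.
apply: (@nielsen_generation n (fun r => eqv r id \/ eqv r (flip i0)))
  => [|s' t s_aut t_aut Ps Pt|i|i j ij|i j ij].
- by left.
- case: Ps Pt => [Ps|Ps] [Pt|Pt].
  + by left; apply: eqv_trans (eqv_idl s_aut t_aut Ps) Pt.
  + by right; apply: eqv_trans (eqv_idl s_aut t_aut Ps) Pt.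
  + by right; apply: eqv_trans (eqv_idr s_aut t_aut Pt) Ps.
  + by left; rewrite -(flipK i0); apply: eqv_comp.
- by right; apply: eqv_flip.
- by right; apply: eqv_trans (eqv_flip j i0); apply: eqv_swap.
- by left; apply: eqv_rho.
Qed.

End Congruence.

(** * Actions on the circle and the interval *)

Section Circle.
Variable R : realType.
Local Open Scope ring_scope.
Implicit Types F G : R -> R.

Lemma circ_eq_refl F : circ_eq F F.
Proof. by exists 0 => x; rewrite addr0. Qed.

Lemma circ_eq_sym F G : circ_eq F G -> circ_eq G F.
Proof. by case=> k FG; exists (- k) => x; rewrite FG mulrNz addrK. Qed.

Lemma circ_eq_trans F G H : circ_eq F G -> circ_eq G H -> circ_eq F H.
Proof.
by case=> k FG [l GH]; exists (l + k) => x; rewrite FG GH mulrzDr addrA.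
Qed.

Lemma lift_addz F : (forall x, F (x + 1) = F x + 1) ->
  forall (k : int) x, F (x + k%:~R) = F x + k%:~R.
Proof.
move=> F1; have Fn (m : nat) x : F (x + m%:R) = F x + m%:R.
  elim: m x => [|m IHm] x; first by rewrite !addr0.
  by rewrite -[in LHS]natr1 addrA F1 IHm -addrA natr1.
case=> m x; first exact: Fn.
by rewrite NegzE mulrNz -[in RHS](subrK m.+1%:R x) Fn addrK.
Qed.

(* The average of the lifts [F t] is an increasing function which [A] and [B]
   shift by constants; conjugating by it turns [A] and [B] into translations. *)
Lemma average_commute (T : finType) (t0 : T) (F : T -> R -> R) (A B : R -> R) :
  (forall t, {homo F t : x y / x < y}) ->
  (exists2 a : T -> T, injective a & forall t, circ_eq (F t \o A) (F (a t))) ->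
  (exists2 b : T -> T, injective b & forall t, circ_eq (F t \o B) (F (b t))) ->
  A \o B =1 B \o A.
Proof.
move=> Finc; pose H x := \sum_t F t x.
have Hinc : {homo H : x y / x < y}.
  move=> x y xy; rewrite /H (bigD1 t0) //= [ltRHS](bigD1 t0) //=.
  by rewrite ltr_leD ?Finc // ler_sum // => t _; rewrite ltW ?Finc.
(* Precomposition with [C] permutes the lifts up to integers, so the sum changes by the total of
   these integers. *)
have shift C : (exists2 a : T -> T, injective a &
    forall t, circ_eq (F t \o C) (F (a t))) -> exists c, forall x, H (C x) = H x + c.
  case=> a a_inj /fin_all_exists[k kE]; exists (\sum_t (k t)%:~R) => x.
  rewrite /H [\sum_t F t x](reindex_inj a_inj) /= -big_split /=.
  by apply: eq_bigr => t _; apply: kE.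
move=> /shift[a HA] /shift[b HB] x.
have Hinj : injective H.
  by move=> y z eqH; case: (ltgtP y z) => // /Hinc; rewrite eqH ltxx.
by apply: Hinj; rewrite /= !(HA, HB) addrAC.
Qed.

Variable n : nat.
Variable phi : (FG n -> FG n) -> R -> R.
Hypothesis phi_hom : hom_Aut_S1 phi.

Lemma phi_inc s : is_aut s -> {homo phi s : x y / x < y}.
Proof. by case: phi_hom => + _ => /[apply] -[G [_ [_ [_ [_]]]]]. Qed.

Lemma phi_add1 s : is_aut s -> forall x, phi s (x + 1) = phi s x + 1.
Proof. by case: phi_hom => + _ => /[apply] -[G []]. Qed.

Lemma phi_circ_comp s s' t t' : is_aut s -> is_aut s' -> is_aut t -> is_aut t' ->
  circ_eq (phi s) (phi s') -> circ_eq (phi t) (phi t') ->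
  circ_eq (phi (s \o t)) (phi (s' \o t')).
Proof.
case: phi_hom => _ phiM s_aut s'_aut t_aut t'_aut [k ss'] [l tt'].
apply: circ_eq_trans (phiM _ _ s_aut t_aut) _.
apply: circ_eq_trans (circ_eq_sym (phiM _ _ s'_aut t'_aut)).
exists (k + l) => x /=.
by rewrite tt' (lift_addz (phi_add1 s_aut)) ss' mulrzDr addrA.
Qed.

(** Right multiplication permutes the finite group of signed permutations, hence its lifts up to
    integers. By [average_commute] even the lifts commute, so the integer in [circ_eq] comes only
    from [phi] being multiplicative up to translation. *)
Lemma phi_sp_commute p e q f :
  circ_eq (phi (sp p e \o sp q f)) (phi (sp q f \o sp p e)).
Proof.
case: (phi_hom) => _ phiM; have sp_aut := @is_aut_sp n.
pose T := ({perm 'I_n} * {ffun 'I_n -> bool})%type.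
pose F (t : T) := phi (sp t.1 t.2).
have phi_shift (p' : {perm 'I_n}) (e' : {ffun 'I_n -> bool}) :
    exists2 a : T -> T, injective a &
    forall t, circ_eq (F t \o phi (sp p' e')) (F (a t)).
  exists (fun t : T => ((p' * t.1)%g, [ffun i => t.2 (p' i) (+) e' i])) => [|t].
    move=> [p1 e1] [p2 e2] /= [/mulgI -> /ffunP eqe]; congr pair.
    apply/ffunP => i; have := eqe ((p'^-1)%g i).
    by rewrite !ffunE permKV => /addIb.
  apply: circ_eq_sym; rewrite /F /= -sp_comp; exact: phiM.
have := average_commute (1%g, [ffun=> false]) (F := F) _
  (phi_shift p e) (phi_shift q f).
move=> /(_ (fun t => phi_inc (sp_aut _ _))) commute.
apply: circ_eq_trans (phiM _ _ _ _) _ => //.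
apply: circ_eq_trans (circ_eq_sym (phiM _ _ _ _)) => //.
by exists 0 => x; rewrite addr0; apply: commute.
Qed.

Theorem Aut_S1_image_le2 : (2 < n)%N -> image_le2_S1 phi.
Proof.
move=> n_gt2; pose i0 : 'I_n := Ordinal (ltnW (ltnW n_gt2)).
exists (phi id), (phi (flip i0)).
apply: (congruence_le2 (eqv := fun s t => circ_eq (phi s) (phi t))) => //.
- by move=> s; apply: circ_eq_refl.
- by move=> s t; apply: circ_eq_sym.
- by move=> s t r; apply: circ_eq_trans.
- exact: phi_circ_comp.
- exact: phi_sp_commute.
Qed.

End Circle.

(** * Actions on the interval *)

Section Interval.
Variables (R : realType) (n : nat).
Local Open Scope ring_scope.
Variable phi : (FG n -> FG n) -> R -> R.
Hypothesis phi_hom : hom_Aut_I phi.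

Let phiM s t x : is_aut s -> is_aut t -> Iset x ->
  phi (s \o t) x = phi s (phi t x).
Proof. by case: phi_hom => _ + s_aut t_aut Ix => ->. Qed.

Let phiI s x : is_aut s -> Iset x -> Iset (phi s x).
Proof. by case: phi_hom => + _ => /[apply] -[g [+ _]] => /[apply] -[]. Qed.

Let phi_inc s x y : is_aut s -> Iset x -> Iset y -> x < y -> phi s x < phi s y.
Proof. by case: phi_hom => + _ => /[apply] -[g [_ [_ [_]]]]; apply. Qed.

Let phi_inj s x y : is_aut s -> Iset x -> Iset y -> phi s x = phi s y -> x = y.
Proof.
move=> s_aut Ix Iy eq_xy; case: (ltgtP x y) => //.
  by move/(phi_inc s_aut Ix Iy); rewrite eq_xy ltxx.
by move/(phi_inc s_aut Iy Ix); rewrite eq_xy ltxx.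
Qed.

(** [phi id] is idempotent and injective on the interval. *)
Let phi_id x : Iset x -> phi id x = x.
Proof.
have id_aut := is_aut_id n.
move=> Ix; apply: (phi_inj id_aut _ Ix); first exact: phiI.
by rewrite -phiM.
Qed.

(** If an increasing map moves [x] to one side, a second application moves it further the same way
    and cannot return to [x]. *)
Lemma phi_involution s : is_aut s -> s \o s = id ->
  forall x, Iset x -> phi s x = x.
Proof.
move=> s_aut ss x Ix; have phi2 : phi s (phi s x) = x by rewrite -phiM // ss phi_id.
case: (ltgtP (phi s x) x) => // lt_x; have := lt_x.
  by move/(phi_inc s_aut (phiI s_aut Ix) Ix); rewrite phi2 ltNge ltW.
by move/(phi_inc s_aut Ix (phiI s_aut Ix)); rewrite phi2 ltNge ltW.
Qed.

Theorem Aut_I_trivial : trivial_I phi.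
Proof.
have P_flip (i : 'I_n) : forall x, Iset x -> phi (flip i) x = x.
  by apply: phi_involution; [apply: is_aut_flip | apply: flipK].
apply: nielsen_generation => [|s t s_aut t_aut Ps Pt x Ix|//|i j _|i j ij x Ix].
- exact: phi_id.
- by rewrite phiM // Pt // Ps.
- by apply: phi_involution; [apply: is_aut_swap | apply: swapK].
have rho_aut := is_aut_rho ij; have flip_aut := is_aut_flip j.
(* Since [flip j] acts trivially, the involution [rho i j \o flip j] acts as [rho i j] does. *)
have := phi_involution (is_aut_comp rho_aut flip_aut) (rho_flip_involution ij) Ix.
by rewrite phiM // P_flip.
Qed.

End Interval.

Theorem theorem1p3 (R : realType) (n : nat) : (6 <= n)%N ->
  (forall phi : (FG n -> FG n) -> R -> R, hom_Aut_S1 phi -> image_le2_S1 phi) /\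
  (forall phi : (FG n -> FG n) -> R -> R, hom_Aut_I phi -> trivial_I phi) /\
  (forall phi : (FG n -> FG n) -> R -> R, hom_Out_S1 phi -> image_le2_S1 phi) /\
  (forall phi : (FG n -> FG n) -> R -> R, hom_Out_I phi -> trivial_I phi).
Proof.
move=> n_ge6; have n_gt2 : (2 < n)%N by apply: leq_trans n_ge6.
split=> [phi phi_hom|]; first exact: Aut_S1_image_le2.
split=> [phi phi_hom|]; first exact: Aut_I_trivial.
by split=> phi [phi_hom _]; [apply: Aut_S1_image_le2 | apply: Aut_I_trivial].
Qed.
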